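(* Let $p\ge 1$ be an odd integer and $G=\mathbb{Z}/p\mathbb{Z}$. Let $\Delta$ be a trivial knot in $S^3$, let $L$ be an oriented link in $S^3$ disjoint from $\Delta$, and let $\tilde L$ be the covering link of $L$ in the $p$-fold cyclic cover of $S^3$ branched over $\Delta$. If $V_G(L)\neq V(\tilde L)$, where $V_G(L)$ is the $G$-equivariant Jones polynomial of $L$ and $V(\tilde L)$ is the (augmented) Jones polynomial of $\tilde L$, then the action of $G$ on the Khovanov homology $H^{*,*}(\tilde L)$ with coefficients in $\mathbb{F}_2$ is not trivial.
   Context: All homology is with coefficients in $\mathbb{F}_2$ unless said otherwise. Covering link and diagrams. Let $\tilde L$ be the preimage of $L$ in the $p$-fold cyclic cover of $S^3$ branched over $\Delta$ (again $S^3$), with the lifted orientation. The group $G=\langle\varphi\rangle$ of deck transformations acts on $(S^3,\tilde L)$, and $\varphi$ may be taken to be the rotation of angle $2\pi/p$ around a trivial knot. Hence $\tilde L$ has a planar diagram $\tilde D$ (avoiding the center of rotation) invariant under the planar rotation $\varphi$ of angle $2\pi/p$; the quotient diagram $D=\tilde D/G$ is a diagram of $L$. Khovanov complex (Viro's description). Let $E$ be an oriented link diagram with writhe $w(E)$. A Kauffman state $s$ assigns a marker $+1$ or $-1$ to each crossing. A crossing with marker $+1$ is smoothed by joining the two regions swept when the overcrossing strand is rotated counterclockwise until it meets the undercrossing strand (the $A$-smoothing); marker $-1$ gives the other smoothing. The result is a collection of circles $E_s$. Put $\sigma(s)=\#\{+1\text{ markers}\}-\#\{-1\text{ markers}\}$.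 An enhanced state $S$ is a Kauffman state $s$ together with a sign $+$ or $-$ on each circle of $E_s$; $\tau(S)$ is the algebraic sum of these signs. Put $i(S)=\frac{w(E)-\sigma(s)}{2}$ and $j(S)=\frac{3w(E)-\sigma(s)+2\tau(S)}{2}$. $C^{i,j}(E)$ is the $\mathbb{F}_2$-vector space with basis the enhanced states with $i(S)=i$, $j(S)=j$. The differential $d:C^{i,j}(E)\to C^{i+1,j}(E)$ is $d=\sum_v d_v$ over crossings $v$, with $d_v(S)=\sum_{S'}(S:S')_v\,S'$. Here $(S:S')_v=1$ if the markers of $S$ and $S'$ differ only at $v$, where $S$ has marker $+1$ and $S'$ has marker $-1$, all circles common to the two smoothings have the same signs, and the signs of the circles passing near $v$ change by one of the following rules; otherwise $(S:S')_v=0$. Merging of two circles: $(+,+)\to +$, $(+,-)\to -$, $(-,+)\to -$. Splitting of one circle: $+\to(+,-)$, $+\to(-,+)$, $-\to(-,-)$. The homology $H^{*,*}(E)$ is the Khovanov homology, which depends up to isomorphism only on the oriented link. Equivariant homology. The rotation $\varphi$ permutes the enhanced states of $\tilde D$, preserving $i$ and $j$, and the resulting linear action of $G$ on $C^{*,*}(\tilde D)$ commutes with $d$. Let $\overline{C^{*,*}(\tilde D)}$ be the quotient of $C^{*,*}(\tilde D)$ by the subcomplex spanned by all $\varphi(x)-x$. Its homology $H_G^{*,*}(L)=H_G^{*,*}(D)$ is the $G$-equivariant Khovanov homology (for $G$ of odd order it depends, up to isomorphism, only on the isotopy class of $L$ in $(S^3,\Delta)$). The $G$-action on $H^{*,*}(\tilde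 L)=H^{*,*}(\tilde D)$ is the induced one. Polynomials. The $G$-equivariant Jones polynomial is $V_G(L)(q)=\sum_{i,j}(-1)^iq^j\dim_{\mathbb{F}_2}H_G^{i,j}(L)$. The augmented Jones polynomial $V(\tilde L)$ equals $(q+q^{-1})$ times the original Jones invariant and is given by $V(\tilde L)(q)=\sum_{i,j}(-1)^iq^j\,\mathrm{rank}\,H^{i,j}(\tilde L;\mathbb{Z})$, equivalently $\sum_{i,j}(-1)^iq^j\dim_{\mathbb{F}_2}H^{i,j}(\tilde L)$. *)

(* Defs.v *)
From HB Require Import structures.
From mathcomp Require Import all_boot all_order perm all_algebra.

Set Implicit Arguments.
Unset Strict Implicit.
Unset Printing Implicit Defensive.

Import GRing.Theory Num.Theory.
Local Open Scope ring_scope.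

(** * Oriented link diagrams

   A diagram is given by its signed Gauss code.  A passage is an event met when
   travelling along the link: going through the crossing [x] on the
   overcrossing strand, [inl (x, true)], or on the undercrossing strand,
   [inl (x, false)], or going through a marked point, [inr b].  Marked points
   may be placed anywhere on the strands; they are there so that components
   without crossings can be represented.  Every passage [t] is followed by the
   passage [next_passage t].

   The edges of the diagram are the pieces of strand between two consecutive
   passages; the edge from [t] to [next_passage t] is denoted by [t] itself. *)

Definition passage (X P : Type) : Type := (X * bool + P)%type.

Record diagram := Diagram {
  crossing : finType;
  mark : finType;
  next_passage : {perm passage crossing mark};
  positive : pred crossing
}.

Definition edge (D : diagram) : finType := (crossing D * bool + mark D)%type.

Section Diagram.
Variable D : diagram.

Definition edge_out (t : edge D) : edge D := t.
Definition edge_in (t : edge D) : edge D := (next_passage D)^-1%g t.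

Definition under_in (x : crossing D) := edge_in (inl (x, false)).
Definition under_out (x : crossing D) := edge_out (inl (x, false)).
Definition over_in (x : crossing D) := edge_in (inl (x, true)).
Definition over_out (x : crossing D) := edge_out (inl (x, true)).

Definition writhe : int := \sum_(x : crossing D) (if positive x then 1 else -1).

(** ** Planarity *)

Definition vertex (t : edge D) : crossing D + mark D :=
  match t with inl (x, _) => inl x | inr b => inr b end.

Definition adjacent : rel (edge D) :=
  [rel t t' | [|| t' == next_passage D t, t == next_passage D t'
                | vertex t == vertex t']].

(* A dart is an edge together with a direction, [true] for the direction of
   the link.  [face_next] walks along the boundary of the face on the left.
   The ends of the strands at a crossing are, counterclockwise,
   under_in, over_out, under_out, over_in   if the crossing is positive,
   under_in, over_in,  under_out, over_out  if it is negative,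
   and a walk that arrives by one end leaves by the preceding one. *)
Definition dart : finType := (edge D * bool)%type.

Definition leave (t : edge D) (out : bool) : dart :=
  if out then (edge_out t, true) else (edge_in t, false).

Definition turn (t : edge D) (out : bool) : dart :=
  match t with
  | inl (x, over) => leave (inl (x, ~~ over)) (out (+) (over == positive x))
  | inr b => leave (inr b) (~~ out)
  end.

Definition face_next (d : dart) : dart :=
  if d.2 then turn (next_passage D d.1) false else turn d.1 true.

(* Euler's formula V - E + F = 2C. *)
Definition planar : Prop :=
  (#|crossing D| + #|mark D| + fcard face_next dart
   = #|edge D| + 2 * n_comp adjacent (edge D))%N.

(** ** Diagrams in the punctured plane

   [w t] is the algebraic number of times the edge [t] crosses,
   counterclockwise, a fixed ray from the puncture to infinity.  [holonomy w d] is the winding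
   number around the puncture of the boundary of the face on the left of [d]. *)

Definition dart_winding (w : edge D -> int) (d : dart) : int :=
  if d.2 then w d.1 else - w d.1.

Definition holonomy (w : edge D -> int) (d : dart) : int :=
  \sum_(d' <- orbit face_next d) dart_winding w d'.

(* Let K be a connected component of the diagram.  The puncture lies in one
   face of K and the point at infinity in one face of K.  If these faces are
   different, their holonomies are 1 and -1; all the other holonomies are 0,
   and so are all of them if the two faces are the same.  As the holonomies of
   the faces of K add up to 0, it is enough to ask for at most one face with
   holonomy 1. *)
Definition annular_winding (w : edge D -> int) : Prop :=
  (forall d, holonomy w d \in [:: -1; 0; 1]) /\
  (forall d d', connect adjacent d.1 d'.1 ->
     holonomy w d = 1 -> holonomy w d' = 1 -> fconnect face_next d d').

(** * The Khovanov complex over F_2 *)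

(* [true] is the marker +1. *)
Definition kauffman_state : finType := {ffun crossing D -> bool}.

(* The pieces of strand that form the smoothed diagram at the crossings, and
   at the marked points.  In the cyclic orders of ends given above, the
   A-smoothing joins the 1st end to the 2nd and the 3rd to the 4th, the other
   one joins the 2nd to the 3rd and the 4th to the 1st.  For a positive
   crossing the A-smoothing is the oriented one, for a negative crossing the
   other one is. *)
Definition joined (s : kauffman_state) (e e' : edge D) : bool :=
  [exists x : crossing D,
     if s x == positive x then
       ((e, e') == (under_in x, over_out x)) ||
       ((e, e') == (over_in x, under_out x))
     else
       ((e, e') == (under_in x, over_in x)) ||
       ((e, e') == (under_out x, over_out x))]
  || [exists b : mark D, (e, e') == (edge_in (inr b), edge_out (inr b))].

(* Circles of the smoothed diagram, as sets of edges. *)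
Definition circle (s : kauffman_state) (e : edge D) : {set edge D} :=
  [set e' | connect [rel a b | joined s a b || joined s b a] e e'].

Definition circles (s : kauffman_state) : {set {set edge D}} :=
  [set circle s e | e : edge D].

(* The signs of the circles ([true] is +) are given as a function on the edges
   that is constant on every circle. *)
Definition is_enhanced
    (S : kauffman_state * {ffun edge D -> bool}) : bool :=
  [forall e, forall e' in circle S.1 e, S.2 e' == S.2 e].

Definition enhanced_state : finType :=
  {S : kauffman_state * {ffun edge D -> bool} | is_enhanced S}.

Definition marker (S : enhanced_state) : kauffman_state := (val S).1.
Definition sign (S : enhanced_state) : {ffun edge D -> bool} := (val S).2.

Definition sigma (s : kauffman_state) : int :=
  \sum_(x : crossing D) (if s x then 1 else -1).

Definition tau (S : enhanced_state) : int :=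
  \sum_(C in circles (marker S))
     (if [forall e in C, sign S e] then 1 else -1).

(* Both divisions are exact. *)
Definition bidegree (S : enhanced_state) : int * int :=
  (((writhe - sigma (marker S))%R %/ 2)%Z,
   ((3 * writhe - sigma (marker S) + 2 * tau S)%R %/ 2)%Z).

(* (S : S')_v.  The circles passing near v are those of the edges under_in v
   and under_out v: each of the two pieces of strand that a smoothing puts at v
   contains one of these two ends. *)
Definition incident (v : crossing D) (S S' : enhanced_state) : bool :=
  let s := marker S in let s' := marker S' in
  let a := under_in v in let b := under_out v in
  [&& s v, ~~ s' v, [forall x, (x != v) ==> (s x == s' x)],
      [forall e, (circle s e == circle s' e) ==> (sign S e == sign S' e)] &
      if circle s a != circle s b then
        (* merging *)
        [&& circle s' a == circle s' b,
            sign S a || sign S b & sign S' a == (sign S a && sign S b)]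
      else
        (* splitting *)
        (circle s' a != circle s' b) &&
        (if sign S a then sign S' a (+) sign S' b
         else ~~ sign S' a && ~~ sign S' b)].

Definition chain : vectType 'F_2 := {ffun enhanced_state -> ('F_2)^o}.

Definition basis_chain (S : enhanced_state) : chain :=
  [ffun S' => (S' == S)%:R].

(* The linear map that sends every S to the sum of the S' with r S S'. *)
Definition extend_fun (r : rel enhanced_state) (c : chain) : chain :=
  [ffun S' => \sum_(S | r S S') c S].

Lemma extend_fun_linear (r : rel enhanced_state) : linear (extend_fun r).
Proof.
move=> k c c'; apply/ffunP=> S'; rewrite !ffunE scaler_sumr -big_split /=.
by apply: eq_bigr => S _; rewrite !ffunE.
Qed.

HB.instance Definition _ (r : rel enhanced_state) :=
  GRing.isLinear.Build 'F_2 chain chain *:%R (extend_fun r)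
    (extend_fun_linear r).

Definition extend (r : rel enhanced_state) : 'End(chain) :=
  linfun (extend_fun r).

Definition khovanov_d : 'End(chain) :=
  \sum_(v : crossing D) extend (incident v).

Definition chains (ij : int * int) : {vspace chain} :=
  <<[seq basis_chain E | E <- enum enhanced_state & bidegree E == ij]>>%VS.

(* For a graded subcomplex N, the homology of C / N in bidegree (i, j) is the
   quotient of [cycles N (i, j)] by [boundaries N (i, j)]; it is the homology
   of C if N = 0.  Boundaries are cycles, as d o d = 0 on planar diagrams; the
   intersection is there so that [homology_dim] is a dimension of a quotient
   without appealing to this fact. *)
Definition cycles (N : {vspace chain}) (ij : int * int) : {vspace chain} :=
  (chains ij :&: khovanov_d @^-1: N)%VS.

Definition boundaries (N : {vspace chain}) (ij : int * int) : {vspace chain} :=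
  (khovanov_d @: chains (ij.1 - 1, ij.2) + (chains ij :&: N))%VS.

Definition homology_dim (N : {vspace chain}) (ij : int * int) : nat :=
  (\dim (cycles N ij) - \dim (cycles N ij :&: boundaries N ij))%N.

(* Sum of (-1)^i q^j h(i,j), a Laurent polynomial viewed as a rational
   function of q; the bidegrees left out are those where the chain space, hence
   the homology, is 0. *)
Definition q_series (h : int * int -> nat) : {fraction {poly int}} :=
  \sum_(ij <- undup (codom bidegree))
     (-1) ^ ij.1 * (tofrac 'X : {fraction {poly int}}) ^ ij.2 * (h ij)%:R.

(* This is (q + q^-1) times the original Jones polynomial. *)
Definition jones : {fraction {poly int}} := q_series (homology_dim 0%VS).

End Diagram.

(** * Covering diagrams

   The complement in S^3 of a trivial knot Delta is identified with
   (plane minus a point) x R, so that a link disjoint from Delta is given by a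
   diagram in the punctured plane. *)

Record annular_diagram := AnnularDiagram {
  base :> diagram;
  winding : edge base -> int;
  base_planar : planar base;
  winding_annular : annular_winding winding
}.

Section Cover.
Variables (p : nat) (L : annular_diagram).

(* [lift_passage t k] is the lift of the passage [t] to the k-th sheet, and also
   the lift of the edge [t] that starts there.  Sheets are separated by the
   lifts of the ray, and numbered modulo p. *)
Definition lift_passage (t : edge L) (k : 'I_p) :
    passage (crossing L * 'I_p) (mark L * 'I_p) :=
  match t with
  | inl (x, over) => inl ((x, k), over)
  | inr b => inr (b, k)
  end.

Definition proj_passage (u : passage (crossing L * 'I_p) (mark L * 'I_p)) :
    edge L * 'I_p :=
  match u with
  | inl ((x, k), over) => (inl (x, over), k)
  | inr (b, k) => (inr b, k)
  end.

Definition shift (n : int) (k : 'I_p) : 'I_p :=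
  iter `|(n %% p)%Z|%N (@ordS p) k.

Definition cover_next_fun (u : passage (crossing L * 'I_p) (mark L * 'I_p)) :=
  let: (t, k) := proj_passage u in
  lift_passage (next_passage L t) (shift (winding t) k).

Lemma cover_next_inj : injective cover_next_fun.
Proof.
have liftK : forall t k, proj_passage (lift_passage t k) = (t, k).
  by case=> [[x o]|b] k.
have projK : cancel proj_passage (fun tk => lift_passage tk.1 tk.2).
  by case=> [[[x k] o]|[b k]].
move=> u u' /(congr1 proj_passage); rewrite /cover_next_fun.
case Eu: (proj_passage u) => [t k]; case Eu': (proj_passage u') => [t' k'].
rewrite !liftK => -[/perm_inj tt' kk']; apply: (can_inj projK).
rewrite {}Eu {}Eu' {}tt' in kk' *; congr (_, _).
by move: kk'; rewrite /shift; elim: `|_|%N => //= n IHn /ordS_inj.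
Qed.

Definition covering_diagram : diagram :=
  @Diagram (crossing L * 'I_p)%type (mark L * 'I_p)%type
    (perm cover_next_inj) (fun xk => positive xk.1).

(** ** The rotation of the covering diagram *)

Definition rot_crossing (xk : crossing covering_diagram) :
    crossing covering_diagram :=
  (xk.1, ordS xk.2).

Definition rot_edge (u : edge covering_diagram) : edge covering_diagram :=
  let: (t, k) := proj_passage u in lift_passage t (ordS k).

(* S' is the image of S. *)
Definition rotated (S S' : enhanced_state covering_diagram) : bool :=
  [forall x, marker S' (rot_crossing x) == marker S x] &&
  [forall e, sign S' (rot_edge e) == sign S e].

Definition phi : 'End(chain covering_diagram) := extend rotated.

(* The subcomplex spanned by all phi x - x. *)
Definition coinvariant_kernel : {vspace chain covering_diagram} :=
  limg (phi - \1)%VF.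

Definition equivariant_jones : {fraction {poly int}} :=
  q_series covering_diagram (homology_dim coinvariant_kernel).

(* The action of the cyclic group of order p, whose elements are the powers of
   phi, fixes every homology class. *)
Definition acts_trivially_on_homology : Prop :=
  forall (k : 'I_p) (ij : int * int) (z : chain covering_diagram),
    z \in cycles 0%VS ij -> iter k phi z - z \in boundaries 0%VS ij.

End Cover.

(* Main.v *)
Require Import Defs.
From mathcomp Require Import all_boot all_order all_algebra.
From mathcomp Require Import perm.

Set Implicit Arguments.
Unset Strict Implicit.
Unset Printing Implicit Defensive.

Import GRing.Theory.
Local Open Scope ring_scope.

(** The theorem is the contrapositive of this: if the group acts trivially on
    the homology of the covering diagram, then the homology of the quotient
    complex has the same dimension in every bidegree, so that the two
    polynomials agree term by term.

    As p is odd, it is invertible in F_2, and averaging over the powers of the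
    rotation phi is a projector a of the chain space ([average]).  It commutes
    with d and preserves the bidegree because phi does, and its kernel is
    exactly the subcomplex N spanned by the phi x - x ([lker_average]).  Hence
    the complex splits as the image of a plus N, and the quotient complex C / N
    is identified with the image of a.  Let Z be the cycles and B the boundaries
    of C in some bidegree.  The homology of C / N is the image a(Z) modulo
    a(Z :&: B), while the rest of the homology of C is carried by Z :&: N.  If
    the action on homology is trivial, then z and a(z) always differ by a
    boundary; for z in Z :&: N, where a(z) = 0, this says that z is a boundary,
    so that this rest vanishes ([quotient_homology_dim]).

    What is needed of the rotation is therefore that phi has order dividing p,
    commutes with d and preserves the bidegree.  The last two hold for every
    automorphism of a diagram, that is, for every relabelling of the crossings
    and marked points that is compatible with the passages and the signs of
    crossings, since the circles of a smoothing, and with them the gradings and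
    the incidence numbers, are defined from these data only.  The rotation of
    the covering diagram is such an automorphism because shifting the sheets
    commutes with the shift by the winding number of an edge. *)

(** * Homology of the coinvariants of a finite-order endomorphism *)

Section Splitting.
Variables (K : fieldType) (V : vectType K) (d f : 'End(V)) (C C' : {vspace V}).
Hypothesis f_idem : forall x, f (f x) = f x.
Hypothesis df : forall x, f (d x) = d (f x).
Hypothesis fC : (f @: C <= C)%VS.
Hypothesis fC' : (f @: C' <= C')%VS.

Local Notation N := (lker f).
Local Notation Z := ((C :&: d @^-1: 0)%VS).
Local Notation ZN := ((C :&: d @^-1: N)%VS).
Local Notation B := ((d @: C')%VS).

(** A chain x of [C] is a cycle modulo [N] exactly when f x is a cycle, because
    [f] commutes with [d] and has kernel [N]. *)
Lemma quotient_cycles_img : (f @: ZN = f @: Z)%VS.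
Proof.
apply/eqP; rewrite eqEsubv.
apply/andP; split; apply/subvP=> _ /memv_imgP[x + ->].
  rewrite memv_cap -memv_preim memv_ker df => /andP[Cx dfx0].
  rewrite -f_idem memv_img // memv_cap -memv_preim memv0 dfx0 andbT.
  by apply: (subvP fC); rewrite memv_img.
rewrite memv_cap -memv_preim memv0 => /andP[Cx /eqP dx0].
by rewrite memv_img // memv_cap Cx -memv_preim dx0 mem0v.
Qed.

(** Applying [f] kills the summand in [N] of a boundary modulo [N] and turns
    the other summand into a boundary, as [f] commutes with [d] and preserves
    [C']. *)
Lemma quotient_boundaries_img :
  (f @: (ZN :&: (B + C :&: N)) = f @: (Z :&: B))%VS.
Proof.
apply/eqP; rewrite eqEsubv.
apply/andP; split; apply/subvP=> _ /memv_imgP[x + ->].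
  rewrite memv_cap => /andP[ZNx /memv_addP[b Bb [n]]].
  rewrite memv_cap memv_ker => /andP[_ /eqP fn0] xE.
  have fxb : f x = f b by rewrite xE linearD /= fn0 addr0.
  rewrite -f_idem memv_img // memv_cap; apply/andP; split.
    move: ZNx; rewrite !memv_cap -!memv_preim memv_ker memv0 df.
    by case/andP=> Cx ->; rewrite andbT; apply: (subvP fC); rewrite memv_img.
  case/memv_imgP: Bb fxb => c C'c -> ->; rewrite df memv_img //.
  by apply: (subvP fC'); rewrite memv_img.
rewrite memv_cap => /andP[Zx Bx]; rewrite memv_img // memv_cap.
rewrite (subvP (addvSl _ _) _ Bx) andbT.
move: Zx; rewrite !memv_cap -!memv_preim memv0 => /andP[-> /eqP->].
exact: mem0v.
Qed.

(** Rank-nullity for [f], applied to cycles and boundaries, splits both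
    homologies into an image part and a part inside [N].  The image parts agree
    by the two lemmas above.  The part inside [N] is 0 for the quotient, where
    all of [C :&: N] is a boundary, and 0 for [C] because z = - (f z - z) if
    f z = 0. *)
Theorem quotient_homology_dim :
    (forall z, z \in Z -> f z - z \in B) ->
  (\dim ZN - \dim (ZN :&: (B + C :&: N)) = \dim Z - \dim (Z :&: B))%N.
Proof.
move=> trivial.
rewrite -(limg_ker_dim f (ZN :&: _)) -(limg_ker_dim f ZN).
rewrite -(limg_ker_dim f (Z :&: B)) -(limg_ker_dim f Z).
rewrite quotient_cycles_img quotient_boundaries_img.
have -> : (ZN :&: (B + C :&: N) :&: N = ZN :&: N)%VS.
  apply/eqP; rewrite eqEsubv capvS ?capvSl //=.
  apply/subvP=> x; rewrite !memv_cap => /andP[/andP[Cx ->] Nx].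
  by rewrite Cx Nx (subvP (addvSr _ _)) // memv_cap Cx Nx.
have -> : (Z :&: B :&: N = Z :&: N)%VS.
  apply/eqP; rewrite eqEsubv capvS ?capvSl //=.
  apply/subvP=> x /memv_capP[Zx Nx].
  rewrite !(memv_cap x _ B, memv_cap x _ N) Zx Nx andbT /=.
  have := trivial _ Zx.
  by move: Nx; rewrite memv_ker => /eqP->; rewrite sub0r rpredN.
by rewrite !subnDl.
Qed.

End Splitting.

Section Averaging.
Variables (K : fieldType) (V : vectType K) (g : 'End(V)) (p : nat).
Hypothesis p_neq0 : p%:R != 0 :> K.
Hypothesis g_order : forall x, iter p g x = x.

Definition average : 'End(V) :=
  p%:R^-1 *: \sum_(k < p) iter k (comp_lfun g) \1%VF.

Lemma averageE x : average x = p%:R^-1 *: \sum_(k < p) iter k g x.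
Proof.
rewrite scale_lfunE sum_lfunE; congr (_ *: _); apply: eq_bigr => k _.
by elim: (k : nat) => [|n IHn] /=; rewrite ?id_lfunE // comp_lfunE IHn.
Qed.

Lemma sum_iter_shift x :
  \sum_(k < p) iter k g (g x) = \sum_(k < p) iter k g x.
Proof.
case: p g_order => [|n] gn; first by rewrite !big_ord0.
rewrite big_ord_recr big_ord_recl /= -(iterSr n) gn addrC; congr (_ + _).
by apply: eq_bigr => i _; rewrite -iterSr.
Qed.

Lemma average_g x : average (g x) = average x.
Proof. by rewrite !averageE sum_iter_shift. Qed.

Lemma average_fix x : g x = x -> average x = x.
Proof.
move=> gx; rewrite averageE (eq_bigr (fun=> x)) => [|k _].
  by rewrite sumr_const card_ord -scaler_nat scalerA mulVf ?scale1r.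
by elim: (k : nat) => //= n ->.
Qed.

Lemma average_comm (d : 'End(V)) : (forall x, g (d x) = d (g x)) ->
  forall x, average (d x) = d (average x).
Proof.
move=> gd x; rewrite !averageE linearZ; congr (_ *: _); rewrite linear_sum /=.
apply: eq_bigr => k _; elim: (k : nat) => //= n ->; exact: gd.
Qed.

Lemma g_average x : g (average x) = average x.
Proof. by rewrite -average_comm // average_g. Qed.

Lemma average_sub (U : {vspace V}) :
  (g @: U <= U)%VS -> (average @: U <= U)%VS.
Proof.
move=> gU; apply/subvP=> _ /memv_imgP[x Ux ->]; rewrite averageE memvZ //.
apply: memv_suml => k _; elim: (k : nat) => //= n IHn.
by apply: (subvP gU); rewrite memv_img.
Qed.

Lemma average_subr x : average x - x = p%:R^-1 *: \sum_(k < p) (iter k g x - x).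
Proof.
rewrite averageE sumrB sumr_const card_ord scalerBr; congr (_ - _).
by rewrite -scaler_nat scalerA mulVf ?scale1r.
Qed.

(** Averaging kills g y - y by invariance; conversely, if the average of x is 0,
    then - x is the mean of the g^k x - x, which telescope into terms of the
    form g y - y. *)
Lemma lker_average : lker average = limg (g - \1)%VF.
Proof.
apply/eqP; rewrite eqEsubv; apply/andP; split; apply/subvP=> x.
  rewrite memv_ker => /eqP ax0; rewrite -[x]opprK -[- x]add0r -ax0.
  rewrite average_subr rpredN memvZ // memv_suml // => k _.
  elim: (k : nat) => [|n IHn] /=; first by rewrite subrr mem0v.
  (* g^(n+1) x - x = (g y - y) + (y - x) with y = g^n x. *)
  rewrite -(subrK (iter n g x) (g _)) -addrA rpredD //.
  apply/memv_imgP; exists (iter n g x); first exact: memvf.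
  by rewrite add_lfunE opp_lfunE id_lfunE.
case/memv_imgP=> y _ ->.
by rewrite add_lfunE opp_lfunE id_lfunE memv_ker linearB /= average_g subrr.
Qed.

(** The projector of [quotient_homology_dim] is the average; it moves a cycle by
    a mean of the boundaries g^k z - z. *)
Theorem coinvariant_homology_dim (d : 'End(V)) (C C' : {vspace V}) :
    (forall x, g (d x) = d (g x)) -> (g @: C <= C)%VS -> (g @: C' <= C')%VS ->
    let N := limg (g - \1)%VF in
    let Z := (C :&: d @^-1: 0)%VS in let ZN := (C :&: d @^-1: N)%VS in
    let B := (d @: C')%VS in
    (forall k z, (k < p)%N -> z \in Z -> iter k g z - z \in B) ->
  (\dim ZN - \dim (ZN :&: (B + C :&: N)) = \dim Z - \dim (Z :&: B))%N.
Proof.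
move=> gd gC gC' N Z ZN B trivial; rewrite /ZN /N -lker_average.
apply: quotient_homology_dim; try exact: average_sub.
- by move=> x; rewrite average_fix // g_average.
- exact: average_comm.
- move=> z Zz; rewrite average_subr memvZ // memv_suml // => k _.
  exact: trivial.
Qed.

End Averaging.

(** * Reindexing along injections of finite types *)

Lemma forall_reindex (T : finType) (f : T -> T) (P : pred T) :
  injective f -> [forall x, P (f x)] = [forall x, P x].
Proof.
move=> f_inj; apply/forallP/forallP=> allP x //.
by rewrite -(f_invF f_inj x).
Qed.

Lemma exists_reindex (T : finType) (f : T -> T) (P : pred T) :
  injective f -> [exists x, P (f x)] = [exists x, P x].
Proof.
move=> f_inj; apply: negb_inj; rewrite !negb_exists.
exact: (forall_reindex (fun x => ~~ P x)).
Qed.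

Lemma connect_mono (T : finType) (f : T -> T) (r r' : rel T) :
  injective f -> {mono f : x y / r x y >-> r' x y} ->
  {mono f : x y / connect r x y >-> connect r' x y}.
Proof.
move=> f_inj mono_f x y.
apply/connectP/connectP=> [[s r's fy]|[s rs ->]]; last first.
  by exists (map f s); rewrite ?last_map // (mono_path mono_f).
have sE : s = map f (map (invF f_inj) s).
  by rewrite -map_comp map_id_in // => z _ /=; rewrite f_invF.
move: r's fy; rewrite {}sE (mono_path mono_f) last_map => rs /f_inj fy.
by exists (map (invF f_inj) s).
Qed.

(** * Automorphisms of diagrams *)

Section MapPassage.
Variables (X P : finType) (f : {perm X}) (g : {perm P}).

Definition map_passage (t : passage X P) : passage X P :=
  match t with inl (x, over) => inl (f x, over) | inr b => inr (g b) end.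

End MapPassage.

Lemma map_passageK (X P : finType) (f : {perm X}) (g : {perm P}) :
  cancel (map_passage f g) (map_passage f^-1 g^-1).
Proof. by case=> [[x o]|b] /=; rewrite permK. Qed.

Lemma map_passageVK (X P : finType) (f : {perm X}) (g : {perm P}) :
  cancel (map_passage f^-1 g^-1) (map_passage f g).
Proof. by case=> [[x o]|b] /=; rewrite permKV. Qed.

Record automorphism (D : diagram) := Automorphism {
  aut_crossing : {perm crossing D};
  aut_mark : {perm mark D};
  aut_next : forall t : edge D,
    next_passage D (map_passage aut_crossing aut_mark t) =
    map_passage aut_crossing aut_mark (next_passage D t);
  aut_positive : forall x, positive (aut_crossing x) = positive x
}.

Section Automorphism.
Variables (D : diagram) (a : automorphism D).

Local Notation ac := (aut_crossing a).

Definition aut_edge : edge D -> edge D := map_passage ac (aut_mark a).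
Local Notation ae := aut_edge.
Definition aut_edge_inv : edge D -> edge D := map_passage ac^-1 (aut_mark a)^-1.

Lemma aut_edgeK : cancel ae aut_edge_inv. Proof. exact: map_passageK. Qed.
Lemma aut_edgeVK : cancel aut_edge_inv ae. Proof. exact: map_passageVK. Qed.
Lemma aut_edge_inj : injective ae. Proof. exact: can_inj aut_edgeK. Qed.

Lemma aut_edge_in t : edge_in (ae t) = ae (edge_in t).
Proof.
by apply: (@perm_inj _ (next_passage D)); rewrite permKV aut_next permKV.
Qed.

Lemma aut_under_in x : under_in (ac x) = ae (under_in x).
Proof. by rewrite /under_in -aut_edge_in. Qed.
Lemma aut_under_out x : under_out (ac x) = ae (under_out x). Proof. by []. Qed.
Lemma aut_over_in x : over_in (ac x) = ae (over_in x).
Proof. by rewrite /over_in -aut_edge_in. Qed.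
Lemma aut_over_out x : over_out (ac x) = ae (over_out x). Proof. by []. Qed.

Definition aut_state (s : kauffman_state D) : kauffman_state D :=
  [ffun x => s (ac^-1%g x)].

Lemma aut_stateE s x : aut_state s (ac x) = s x.
Proof. by rewrite ffunE permK. Qed.

(** Smoothings are described by the ends of the strands at a crossing, by its
    sign and by its marker, and an automorphism carries all of these along. *)
Lemma aut_joined s :
  {mono ae : e e' / joined s e e' >-> joined (aut_state s) e e'}.
Proof.
move=> e e'; have eq_pair (u u' v v' : edge D) :
    ((ae u, ae u') == (ae v, ae v')) = ((u, u') == (v, v')).
  by rewrite !xpair_eqE !(inj_eq aut_edge_inj).
rewrite /joined -(exists_reindex _ (@perm_inj _ ac)).
rewrite -(exists_reindex _ (@perm_inj _ (aut_mark a))).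
congr (_ || _); apply: eq_existsb => x.
  by rewrite aut_stateE aut_positive aut_under_in aut_over_in aut_under_out
             aut_over_out !eq_pair.
by rewrite -(eq_pair _ _ (edge_in (inr x))) -aut_edge_in.
Qed.

Lemma aut_mem_circle s e e' :
  (ae e' \in circle (aut_state s) (ae e)) = (e' \in circle s e).
Proof.
rewrite !inE; apply: connect_mono; first exact: aut_edge_inj.
by move=> u v /=; rewrite !aut_joined.
Qed.

Lemma aut_circle s e : circle (aut_state s) (ae e) = ae @: circle s e.
Proof.
apply/setP=> e'; rewrite -(aut_edgeVK e') aut_mem_circle.
by rewrite (mem_imset _ _ aut_edge_inj).
Qed.

Lemma aut_circles s :
  circles (aut_state s) = [set ae @: C | C : {set edge D} in circles s].
Proof.
rewrite -imset_comp; apply/setP=> C; apply/imsetP/imsetP=> -[e _ ->].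
  by exists (aut_edge_inv e); rewrite // /= -aut_circle aut_edgeVK.
by exists (ae e); rewrite // /= -aut_circle.
Qed.

Lemma aut_circle_eq s s' e e' :
  (circle (aut_state s) (ae e) == circle (aut_state s') (ae e')) =
  (circle s e == circle s' e').
Proof. by rewrite !aut_circle (inj_eq (imset_inj aut_edge_inj)). Qed.

Lemma aut_is_enhanced (S : enhanced_state D) :
  is_enhanced (aut_state (marker S), [ffun e => sign S (aut_edge_inv e)]).
Proof.
apply/forallP=> e; apply/forall_inP=> e' /=.
rewrite -(aut_edgeVK e) -(aut_edgeVK e') aut_mem_circle !ffunE !aut_edgeK.
by have /forallP/(_ (aut_edge_inv e))/forall_inP := valP S; apply.
Qed.

Definition aut_enhanced (S : enhanced_state D) : enhanced_state D :=
  Sub (aut_state (marker S), [ffun e => sign S (aut_edge_inv e)])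
      (aut_is_enhanced S).

Lemma aut_marker S : marker (aut_enhanced S) = aut_state (marker S).
Proof. by []. Qed.

Lemma aut_sign S e : sign (aut_enhanced S) (ae e) = sign S e.
Proof. by rewrite /sign /= ffunE aut_edgeK. Qed.

Lemma enhanced_state_eq (S S' : enhanced_state D) :
  marker S =1 marker S' -> sign S =1 sign S' -> S = S'.
Proof.
move=> /ffunP eq_marker /ffunP eq_sign; apply: val_inj.
by rewrite [LHS]surjective_pairing [RHS]surjective_pairing; congr (_, _).
Qed.

Lemma aut_enhanced_inj : injective aut_enhanced.
Proof.
move=> S S' eqSS'; apply: enhanced_state_eq => [x|e].
  by rewrite -aut_stateE -aut_marker eqSS' aut_marker aut_stateE.
by rewrite -aut_sign eqSS' aut_sign.
Qed.

Lemma aut_sigma s : sigma (aut_state s) = sigma s.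
Proof.
rewrite /sigma (reindex_inj (@perm_inj _ ac)).
by apply: eq_bigr => x _; rewrite aut_stateE.
Qed.

Lemma aut_tau S : tau (aut_enhanced S) = tau S.
Proof.
rewrite /tau aut_marker aut_circles big_imset /=; last first.
  by move=> C C' _ _; apply: imset_inj aut_edge_inj _ _.
apply: eq_bigr => C _; rewrite -(forall_reindex _ aut_edge_inj).
rewrite (@eq_forallb _ _ (fun e => (e \in C) ==> sign S e)) // => e.
by rewrite aut_sign (mem_imset _ _ aut_edge_inj).
Qed.

Lemma aut_bidegree S : bidegree (aut_enhanced S) = bidegree S.
Proof. by rewrite /bidegree aut_tau aut_marker aut_sigma. Qed.

Lemma aut_incident v S S' :
  incident (ac v) (aut_enhanced S) (aut_enhanced S') = incident v S S'.
Proof.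
rewrite /incident !aut_marker !aut_stateE aut_under_in aut_under_out.
rewrite !aut_circle_eq !aut_sign.
congr [&& _, _, _, _ & _].
  rewrite -(forall_reindex _ (@perm_inj _ ac)); apply: eq_forallb => x.
  by rewrite (inj_eq perm_inj) !aut_stateE.
rewrite -(forall_reindex _ aut_edge_inj); apply: eq_forallb => e.
by rewrite aut_circle_eq !aut_sign.
Qed.

Definition aut_chain : 'End(chain D) :=
  extend [rel S S' | S' == aut_enhanced S].

Lemma extendE (r : rel (enhanced_state D)) (c : chain D) S' :
  extend r c S' = \sum_(S | r S S') c S.
Proof. by rewrite lfunE /= ffunE. Qed.

Lemma aut_chainE (c : chain D) S : aut_chain c (aut_enhanced S) = c S.
Proof.
rewrite extendE (big_pred1 S) // => S' /=.
by rewrite eq_sym (inj_eq aut_enhanced_inj).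
Qed.

(** Every enhanced state is an image, so coefficients need only be compared on
    images, where those of [aut_chain c] are known from [aut_chainE]. *)
Lemma aut_chain_eq (c c' : chain D) :
  (forall S, c (aut_enhanced S) = c' (aut_enhanced S)) -> c = c'.
Proof.
by move=> eq_cc'; apply/ffunP=> S; rewrite -(f_invF aut_enhanced_inj S).
Qed.

Lemma khovanov_dE (c : chain D) S' :
  khovanov_d D c S' = \sum_v \sum_(S | incident v S S') c S.
Proof.
rewrite /khovanov_d sum_lfunE sum_ffunE; apply: eq_bigr => v _; exact: extendE.
Qed.

(** Both sums over a crossing and an enhanced state are reindexed along the
    automorphism, which preserves incidence numbers. *)
Lemma aut_chain_d c : aut_chain (khovanov_d D c) = khovanov_d D (aut_chain c).
Proof.
apply: aut_chain_eq => S'; rewrite aut_chainE !khovanov_dE.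
rewrite [RHS](reindex_inj (@perm_inj _ ac)); apply: eq_bigr => v _.
rewrite [RHS](reindex_inj aut_enhanced_inj).
by apply: eq_big => S; rewrite ?aut_incident ?aut_chainE.
Qed.

Lemma aut_basis_chain S :
  aut_chain (basis_chain S) = basis_chain (aut_enhanced S).
Proof.
apply: aut_chain_eq => S'.
by rewrite aut_chainE !ffunE (inj_eq aut_enhanced_inj).
Qed.

Lemma aut_chains ij : (aut_chain @: chains D ij <= chains D ij)%VS.
Proof.
rewrite limg_span; apply/span_subvP=> _ /mapP[_ /mapP[S + ->] ->].
rewrite mem_filter aut_basis_chain => /andP[/eqP ijS _].
apply/memv_span/map_f.
by rewrite mem_filter mem_enum aut_bidegree ijS eqxx.
Qed.

Lemma aut_iter n c S : iter n aut_chain c (iter n aut_enhanced S) = c S.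
Proof. by elim: n => //= n IHn; rewrite aut_chainE. Qed.

Lemma aut_enhanced_order n :
  iter n ac =1 id -> iter n ae =1 id -> iter n aut_enhanced =1 id.
Proof.
move=> ac_n ae_n S; apply: enhanced_state_eq => [x|e].
  rewrite -{1}(ac_n x); elim: n {ac_n ae_n} => //= n IHn.
  by rewrite aut_marker aut_stateE.
rewrite -{1}(ae_n e); elim: n {ac_n ae_n} => //= n IHn.
by rewrite aut_sign.
Qed.

Lemma aut_chain_order n :
  iter n ac =1 id -> iter n ae =1 id -> iter n aut_chain =1 id.
Proof.
move=> ac_n ae_n c; apply/ffunP=> S.
by rewrite -{1}(aut_enhanced_order ac_n ae_n S) aut_iter.
Qed.

End Automorphism.

(** * The rotation of the covering diagram *)

Section Rotation.
Variables (p : nat) (L : annular_diagram).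
Local Notation D := (covering_diagram p L).

Lemma iter_ordS n (k : 'I_p) : val (iter n (@ordS p) k) = ((k + n) %% p)%N.
Proof.
elim: n => [|n IHn] /=; first by rewrite addn0 modn_small.
by rewrite IHn -addn1 modnDml addn1 addnS.
Qed.

Lemma iter_ordS_id (k : 'I_p) : iter p (@ordS p) k = k.
Proof. by apply: val_inj; rewrite iter_ordS modnDr modn_small. Qed.

Lemma next_sheet_inj (T : Type) :
  injective (fun xk : T * 'I_p => (xk.1, ordS xk.2)).
Proof.
move=> [x k] [x' k'] [-> kk']; congr (_, _).
by apply: ordS_inj; apply: val_inj.
Qed.

Definition rot_crossing_perm : {perm crossing D} :=
  perm (@next_sheet_inj (crossing L)).
Definition rot_mark_perm : {perm mark D} := perm (@next_sheet_inj (mark L)).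

Lemma rot_edgeE : map_passage rot_crossing_perm rot_mark_perm =1 @rot_edge p L.
Proof. by case=> [[[x k] o]|[b k]] /=; rewrite permE. Qed.

Lemma shift_ordS n (k : 'I_p) : shift n (ordS k) = ordS (shift n k).
Proof. by rewrite /shift -iterSr. Qed.

(** Following an edge changes the sheet by a power of the cyclic shift that
    defines the rotation, and such a power commutes with it. *)
Lemma rot_next (t : edge D) :
  next_passage D (map_passage rot_crossing_perm rot_mark_perm t) =
  map_passage rot_crossing_perm rot_mark_perm (next_passage D t).
Proof.
have lift_rot (e : edge L) (k : 'I_p) :
    rot_edge (lift_passage e k : edge D) = lift_passage e (ordS k).
  by case: e => [[x o]|b].
rewrite !rot_edgeE /= !permE /cover_next_fun.
by case: t => [[[x k] o]|[b k]] /=; rewrite lift_rot shift_ordS.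
Qed.

Lemma rot_positive x : @positive D (rot_crossing_perm x) = positive x.
Proof. by rewrite permE. Qed.

Definition rotation : automorphism D := Automorphism rot_next rot_positive.

Lemma rotated_rotation S S' : rotated S S' = (S' == aut_enhanced rotation S).
Proof.
apply/andP/eqP=> [[/forallP eq_marker /forallP eq_sign] | ->]; last first.
  split; apply/forallP=> t.
    have := aut_stateE rotation (marker S) t.
    by rewrite permE aut_marker => ->.
  by rewrite -rot_edgeE (aut_sign rotation).
apply: enhanced_state_eq => [x|e].
  rewrite -(permKV rot_crossing_perm x) aut_marker (aut_stateE rotation).
  by rewrite permE; apply/eqP/eq_marker.
rewrite -(aut_edgeVK rotation e) aut_sign; apply/eqP.
by have := eq_sign (aut_edge_inv rotation e); rewrite -rot_edgeE.
Qed.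

Lemma phiE : phi p L = aut_chain rotation.
Proof.
apply/lfunP=> c; apply/ffunP=> S'; rewrite !extendE.
by apply: eq_bigl => S; rewrite rotated_rotation.
Qed.

Lemma phi_order : iter p (phi p L) =1 id.
Proof.
rewrite phiE; apply: aut_chain_order.
  move=> [x k].
  suff -> n : iter n rot_crossing_perm (x, k) = (x, iter n (@ordS p) k).
    by rewrite iter_ordS_id.
  by elim: n => //= n ->; rewrite permE.
move=> t; have [e [k ->]] : exists e k, t = lift_passage e k.
  case: t => [[[x k] o]|[b k]]; first by exists (inl (x, o)), k.
  by exists (inr b), k.
suff -> n : iter n (aut_edge rotation) (lift_passage e k) =
            lift_passage e (iter n (@ordS p) k).
  by rewrite iter_ordS_id.
by elim: n => //= n ->; rewrite [LHS]rot_edgeE; case: e => [[x o]|b].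
Qed.

Lemma homology_dim_coinvariant ij : odd p -> acts_trivially_on_homology p L ->
  homology_dim (coinvariant_kernel p L) ij = homology_dim (D := D) 0%VS ij.
Proof.
move=> p_odd trivial.
rewrite /homology_dim /cycles /boundaries capv0 addv0.
have p_neq0 : p%:R != 0 :> 'F_2.
  rewrite -[p]odd_double_half p_odd -muln2 natrD natrM.
  by rewrite (_ : 2%:R = 0 :> 'F_2) ?mulr0 //; apply: val_inj.
apply: (coinvariant_homology_dim p_neq0 phi_order).
- by rewrite phiE; exact: aut_chain_d.
- by rewrite phiE; exact: aut_chains.
- by rewrite phiE; exact: aut_chains.
- move=> k z k_lt_p Zz; have := trivial (Ordinal k_lt_p) ij z Zz.
  by rewrite /boundaries capv0 addv0.
Qed.

End Rotation.

Theorem corollary1 (p : nat) (p_odd : odd p) (L : annular_diagram) :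
  equivariant_jones p L <> jones (covering_diagram p L) ->
  ~ acts_trivially_on_homology p L.
Proof.
move=> neq_jones trivial; apply: neq_jones.
apply: eq_bigr => ij _; congr (_ * _%:R).
exact: homology_dim_coinvariant.
Qed.
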